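(* For any integers $a,b\geq 0$ and for any prime $p>t$, where $t=a+b+1$, $$H^q_{p-1}(\{1\}^{a},2,\{1\}^{b})+H^q_{p-1}(\{1\}^{b},2,\{1\}^{a})\equiv-\binom{p+1}{t+2}\frac{(1-q)^{t+1}}{p}\pmod{[p]_q}.$$
   Context: Here $q$ is an indeterminate and $[n]_q=\frac{1-q^n}{1-q}=1+q+\cdots+q^{n-1}$. For positive integers $s_1,\dots,s_l$, $$H_n^q(s_1,\ldots,s_l)=\sum_{1\le k_1<\cdots<k_l\le n}\prod_{i=1}^l\frac{q^{(s_i-1)k_i}}{[k_i]_q^{s_i}}.$$ $\{s\}^t$ denotes $t\ge0$ consecutive copies of $s$. For a prime $p$ and rational functions $A,B$ in $q$, $A\equiv B\pmod{[p]_q}$ means $A-B=f/g$ with $f,g$ polynomials in $q$ with integer coefficients, $g$ coprime to $[p]_q$ in $\mathbb{Q}[q]$, and $[p]_q\mid f$ ($[p]_q$ is the $p$th cyclotomic polynomial, irreducible over $\mathbb{Q}$). *)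

(* Defs.v *)
From mathcomp Require Import all_boot all_order all_algebra.

Set Implicit Arguments.
Unset Strict Implicit.
Unset Printing Implicit Defensive.

Import GRing.Theory.
Local Open Scope ring_scope.

(* The field Q(q) of rational functions; the indeterminate q is qvar. *)
Definition ratfun : fieldType := {fraction {poly rat}}.

Definition qvar : ratfun := tofrac ('X : {poly rat}).

(* [n]_x = 1 + x + ... + x^(n-1), used for x = q in Z[q], Q[q] and Q(q). *)
Definition qint (R : nzRingType) (x : R) (n : nat) : R := \sum_(i < n) x ^+ i.

(* H_n^q(s_1, ..., s_l), l = size s: the predicate path ltn 0 encodes
   0 < k_1 < ... < k_l, and k_l <= n comes from the type of the indices.
   The entries of s are meant to be positive, so that s_i.-1 is s_i - 1. *)
Definition qMHS (n : nat) (s : seq nat) : ratfun :=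
  \sum_(k : (size s).-tuple 'I_n.+1 | path ltn 0%N [seq val j | j <- k])
    \prod_(i < size s)
      (qvar ^+ ((nth 0%N s i).-1 * tnth k i)
         / qint qvar (tnth k i) ^+ nth 0%N s i).

Definition ratfun_of_zpoly (f : {poly int}) : ratfun :=
  tofrac (map_poly intr f : {poly rat}).

(* A = B mod [p]_q. Divisibility is in Z[q]; coprimality, which is in Q[q],
   forces g != 0 for p prime since [p]_q is not constant. *)
Definition qcong (p : nat) (A B : ratfun) : Prop :=
  exists f g : {poly int},
    [/\ A - B = ratfun_of_zpoly f / ratfun_of_zpoly g,
        coprimep (map_poly intr g : {poly rat}) (qint 'X p)
      & exists h : {poly int}, f = h * qint 'X p].

(* Main.v *)
(** At a primitive p-th root of unity z put x_k = 1/(1 - z^k) and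
    u_a = z^a - 1. Up to the factor (1-z)^(t+1), the two sums are the
    coefficients of u^a v^b and u^b v^a in
      G(u,v) = sum_j z^j x_j^2 prod_{k<j} (1 + u x_k) prod_{k>j} (1 + v x_k).
    G has degree at most p-2 in each variable, so G(u,v) + G(v,u) is determined
    by its values at the nodes (u_a, u_b), 0 < a, b < p. There G vanishes for
    a < b, and u_a u_b G(u_a,u_b) = -1 for a >= b: multiplying a node by z acts
    on the partial products as a q-derivative, so the difference of the values
    at a and a+1 telescopes to 0, and the diagonal value is a one-term sum.
    The same telescoping handles sum_j x_j prod prod, whose (a,b) coefficient
    is the elementary symmetric function e_{a+b+1} of the x_k, equal to
    C(p,a+b+2)/p. This identifies G(u,v) + G(v,u) with the generating
    function of -(e_{a+b+1} + e_{a+b+2}) = -C(p+1,a+b+3)/p.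
    A rational function that vanishes at all primitive p-th roots of unity is
    0 modulo [p]_q. *)
Require Import Defs.
From mathcomp Require Import all_boot all_order all_algebra all_field.
From mathcomp Require Import ring zify.
Import GRing.Theory.
Local Open Scope ring_scope.

(** * Nested sums and elementary symmetric functions *)

(** The indices satisfy m < k_1 < ... < k_l < n. The letters have arbitrary type: exponents for the
    harmonic sums, [unit] when all weights agree. *)
Fixpoint nsum (R : nzRingType) (T : Type) (w : T -> nat -> R) n s m :=
  if s is c :: s' then \sum_(m.+1 <= k < n) w c k * nsum R T w n s' k else 1.
Arguments nsum {R T}.

Lemma tuple_nsum (R : comNzRingType) (T : Type) (x0 : T) (w : T -> nat -> R)
    (n m : nat) (s : seq T) :
  \sum_(k : (size s).-tuple 'I_n | path ltn m [seq val j | j <- k])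
    \prod_(i < size s) w (nth x0 s i) (tnth k i) = nsum w n s m.
Proof.
elim: s m => [|c s IHs] m /=.
  rewrite (eq_bigl (pred1 [tuple])) => [|k]; last by rewrite tuple0 /= eqxx.
  by rewrite big_pred1_eq big_ord0.
(* A tuple is split into head and tail; the path condition becomes m < k_1 together with a path
   starting at k_1. *)
rewrite (reindex (fun xt : 'I_n * (size s).-tuple 'I_n =>
  [tuple of xt.1 :: xt.2])) /=; last first.
  exists (fun t => (thead t, [tuple of behead t])) => [[x t] _|t _] /=.
    by congr pair; apply/val_inj.
  by rewrite -tuple_eta.
rewrite big_geq_mkord /=.
under [RHS]eq_bigr => i _ do rewrite -IHs big_distrr /=.
rewrite pair_big_dep /=; apply: eq_bigr => -[i t] _ /=.
rewrite big_ord_recl; congr (_ * _).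
by apply: eq_bigr => j _; rewrite (tnth_nth i) [in RHS](tnth_nth i).
Qed.

(** The coefficient is an elementary symmetric function of the f k; its monomials are sorted by
    their least index. *)
Lemma coef_prod_affine (R : comNzRingType) (f : nat -> R) m n b : (m <= n)%N ->
  (\prod_(m <= k < n) (1 + f k *: 'X))`_b.+1
  = \sum_(m <= k < n) f k * (\prod_(k.+1 <= i < n) (1 + f i *: 'X))`_b.
Proof.
move=> le_mn; rewrite -(subKn le_mn).
elim: (n - m)%N (leq_subr m n) => [|d IHd] le_dn.
  by rewrite subn0 !big_geq // coef1.
have lt_n : (n - d.+1 < n)%N by lia.
have eq_d : (n - d.+1).+1 = (n - d)%N by lia.
rewrite big_ltn // [RHS]big_ltn // eq_d -IHd; last by lia.
by rewrite mulrDl mul1r coefD -scalerAl coefZ coefXM addrC.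
Qed.

Lemma coef0_prod_affine (R : comNzRingType) (f : nat -> R) m n :
  (\prod_(m <= k < n) (1 + f k *: 'X))`_0 = 1.
Proof.
by rewrite coef0_prod big1 // => k _; rewrite coefD coef1 coefZ coefX mulr0 addr0.
Qed.

Lemma size_prod_affine (R : comNzRingType) (f : nat -> R) m n :
  (size (\prod_(m <= k < n) (1 + f k *: 'X))%R <= (n - m).+1)%N.
Proof.
elim: n => [|n IHn]; first by rewrite big_geq // size_poly1.
have [lt_nm|le_mn] := ltnP n m; first by rewrite big_geq // size_poly1.
rewrite big_nat_recr // subSn //; apply: leq_trans (size_polyMleq _ _) _.
have : (size (1 + f n *: 'X)%R <= 2)%N.
  apply: leq_trans (size_polyD _ _) _; rewrite size_poly1 geq_max /=.
  by apply: leq_trans (size_scale_leq _ _) _; rewrite size_polyX.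
move=> le2; rewrite -subn1 leq_subLR add1n.
by rewrite (leq_trans (leq_add IHn le2)) ?addn2.
Qed.

Lemma nsum_nseq (R : comNzRingType) (T : Type) (w : T -> nat -> R) c n b m :
  (m < n)%N ->
  nsum w n (nseq b c) m = (\prod_(m.+1 <= k < n) (1 + w c k *: 'X))`_b.
Proof.
elim: b m => [|b IHb] m lt_mn /=; first by rewrite coef0_prod_affine.
rewrite coef_prod_affine //; apply: eq_big_nat => k /andP[_ lt_kn].
by rewrite IHb.
Qed.

(** Sorts by the index j of the letter d: the a smaller indices contribute an elementary symmetric
    function. The induction peels off the least index k and exchanges the sums over k < j. *)
Lemma nsum_nseq_cons (R : comNzRingType) (T : Type) (w : T -> nat -> R)
    c d n a s m :
  nsum w n (nseq a c ++ d :: s) m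
  = \sum_(m.+1 <= j < n)
      (\prod_(m.+1 <= k < j) (1 + w c k *: 'X))`_a * (w d j * nsum w n s j).
Proof.
elim: a m => [|a IHa] m /=.
  by apply: eq_bigr => j _; rewrite coef0_prod_affine mul1r.
under eq_bigr => k _ do rewrite IHa big_distrr /=.
under [RHS]eq_big_nat => j /andP[lt_mj _] do
  rewrite coef_prod_affine // big_distrl /=.
have tri k : (m.+1 <= k < n)%N -> \sum_(k.+1 <= j < n) w c k *
     ((\prod_(k.+1 <= i < j) (1 + w c i *: 'X))`_a * (w d j * nsum w n s j))
   = \sum_(m.+1 <= j < n | (k < j)%N) w c k *
     ((\prod_(k.+1 <= i < j) (1 + w c i *: 'X))`_a * (w d j * nsum w n s j)).
  move=> /andP[lt_mk _].
  by rewrite (big_nat_widenl k.+1 m.+1) ?leqW //; apply: eq_bigl => j.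
rewrite (eq_big_nat _ _ tri).
rewrite (exchange_big_dep_nat xpredT) //=; apply: eq_big_nat => j /andP[_ lt_jn].
rewrite [RHS](big_nat_widen _ _ n) 1?ltnW //.
by apply: eq_bigr => k _; rewrite mulrA.
Qed.

(** * Coefficients that vanish because the values at enough nodes do *)

Lemma poly_coef_vanish (K : idomainType) n (rs : seq K) (c : nat -> K) :
  uniq rs -> (n <= size rs)%N ->
  (forall r, r \in rs -> \sum_(0 <= i < n) c i * r ^+ i = 0) ->
  forall i, (i < n)%N -> c i = 0.
Proof.
move=> uniq_rs le_n c0 i lt_in.
have : \poly_(i < n) c i = 0.
  apply: (roots_geq_poly_eq0 _ uniq_rs); last first.
    by apply: leq_trans le_n; apply: size_poly.
  apply/allP => r /c0; rewrite /root horner_poly big_mkord => ->; exact: eqxx.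
by move/(congr1 (fun q : {poly K} => q`_i)); rewrite coef_poly lt_in coef0.
Qed.

Lemma bivariate_coef_vanish (K : idomainType) n (rs : seq K)
    (c : nat -> nat -> K) :
  uniq rs -> (n <= size rs)%N ->
  (forall r s, r \in rs -> s \in rs ->
     \sum_(0 <= i < n) \sum_(0 <= j < n) c i j * r ^+ i * s ^+ j = 0) ->
  forall i j, (i < n)%N -> (j < n)%N -> c i j = 0.
Proof.
move=> uniq_rs le_n c0 i j lt_in.
apply: (poly_coef_vanish _ _ _ (c i) uniq_rs le_n) => s s_rs.
apply: (poly_coef_vanish _ _ _ (fun i => \sum_(0 <= j < n) c i j * s ^+ j)
          uniq_rs le_n) lt_in => r r_rs.
rewrite -[RHS](c0 r s r_rs s_rs); apply: eq_bigr => k _.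
by rewrite big_distrl; apply: eq_bigr => l _ /=; rewrite mulrAC.
Qed.

(** * Partial products at the nodes u_a, for a primitive p-th root of unity z *)

Section RootOfUnity.

Variables (K : fieldType) (z : K) (p : nat).
Hypothesis zP : p.-primitive_root z.

Let x k := (1 - z ^+ k)^-1.
Let u a := z ^+ a - 1.
(** As 1 + u_a x_k = (z^a - z^k) x_k, [NP a j] and [NQ b j] are the values at u_a and u_b of the
    products over k < j and over k > j. *)
Let NP a j := \prod_(1 <= k < j) ((z ^+ a - z ^+ k) * x k).
Let NQ b j := \prod_(j.+1 <= k < p) ((z ^+ b - z ^+ k) * x k).

Lemma prim_root_sub1_neq0 k : (0 < k < p)%N -> 1 - z ^+ k != 0.
Proof.
case/andP=> k0 kp; rewrite subr_eq0 eq_sym -(prim_order_dvd zP).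
by apply/negP => /(dvdn_leq k0); rewrite leqNgt kp.
Qed.

Let xK k : (0 < k < p)%N -> x k * (1 - z ^+ k) = 1.
Proof. by move=> kp; rewrite mulVf // prim_root_sub1_neq0. Qed.

Let u_neq0 k : (0 < k < p)%N -> u k != 0.
Proof. by move=> kp; rewrite /u -opprB oppr_eq0 prim_root_sub1_neq0. Qed.

Let ux k : (0 < k < p)%N -> u k * x k = -1.
Proof. by move=> kp; rewrite /u -opprB mulNr mulrC xK. Qed.

Let zpow_inj a b : (a < p)%N -> (b < p)%N -> z ^+ a = z ^+ b -> a = b.
Proof.
move=> ap bp /eqP; rewrite (eq_prim_root_expr zP) !modn_small //.
by move/eqP.
Qed.

Let NP_eq0 a j : (0 < a < j)%N -> NP a j = 0.
Proof.
case/andP=> a0 aj; apply/eqP; rewrite prodf_seq_eq0; apply/hasP; exists a.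
  by rewrite mem_index_iota a0.
by rewrite subrr mul0r eqxx.
Qed.

Let NQ_eq0 b j : (j < b < p)%N -> NQ b j = 0.
Proof.
case/andP=> jb bp; apply/eqP; rewrite prodf_seq_eq0; apply/hasP; exists b.
  by rewrite mem_index_iota jb.
by rewrite subrr mul0r eqxx.
Qed.

Let NP1 a : NP a 1 = 1.
Proof. by rewrite /NP big_geq. Qed.

Let NP_S a j : (0 < j)%N -> NP a j.+1 = NP a j * ((z ^+ a - z ^+ j) * x j).
Proof. by move=> j0; rewrite /NP big_nat_recr. Qed.

Let NQ_S b j : (j.+1 < p)%N ->
  NQ b j = (z ^+ b - z ^+ j.+1) * x j.+1 * NQ b j.+1.
Proof. by move=> jp; rewrite /NQ big_ltn. Qed.

(** Each z^(a+1) - z^k is z (z^a - z^(k-1)), so the numerators move down by one index and the new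
    one, at k = 0, is u_a. *)
Let NP_shift a j : (0 < j)%N ->
  NP a.+1 j.+1 = z ^+ j * u a * x j * NP a j.
Proof.
case: j => // j _; rewrite /NP !big_split /=.
rewrite [\prod_(1 <= k < j.+2) x k]big_nat_recr //= big_add1 /=.
under eq_bigr => k _ do rewrite !exprS -mulrBr.
rewrite big_split /= prodr_const_nat subn0 big_ltn // expr0 -/(u a).
ring.
Qed.

Let NQ_shift b j : (j.+1 < p)%N ->
  NQ b j = u b.+1 * z ^+ j.+1 * x j.+1 * NQ b.+1 j.+1.
Proof.
move=> lt_jp; have zp1 := prim_expr_order zP.
move: lt_jp zp1; rewrite /NQ; case: (p) => // q lt_jq zq1.
rewrite !big_split /= [\prod_(j.+1 <= k < q.+1) x k]big_ltn //.
rewrite [\prod_(j.+1 <= k < q.+1) (_ - _)]big_nat_recr //=.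
rewrite [in RHS]big_add1 /=.
under [in RHS]eq_bigr => k _ do rewrite !exprS -mulrBr.
rewrite big_split /= prodr_const_nat.
(* The top numerator wraps around: it equals (z^(b+1) - 1) z^q since z^(q+1) = 1. The power
   z^(q-j-1) is the one coming from the shifted factors. *)
have -> : z ^+ b - z ^+ q = u b.+1 * z ^+ j.+1 * z ^+ (q - j.+1).
  rewrite -mulrA -exprD subnKC // /u mulrBl -exprD addSnnS exprD zq1.
  by rewrite mulr1 mul1r.
ring.
Qed.

Let uxNP a j : (0 < j < p)%N -> u a * x j * NP a j = NP a j.+1 - NP a j.
Proof.
move=> jp; rewrite NP_S; last by case/andP: jp.
have -> : u a * x j * NP a j
  = NP a j * ((z ^+ a - z ^+ j) * x j) - NP a j * (x j * (1 - z ^+ j)).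
  by rewrite /u; ring.
by rewrite xK // mulr1.
Qed.

(** A q-derivative in T = z^a: beyond the common factor [NP a j * x j] there remains (z^a - z^j) -
    z^j (z^a - 1) = z^a (1 - z^j). *)
Let NP_qderiv a j : (0 < j < p)%N -> NP a j.+1 - NP a.+1 j.+1 = z ^+ a * NP a j.
Proof.
move=> jp; have j0 : (0 < j)%N by case/andP: jp.
rewrite NP_S // NP_shift // -[RHS]mulr1 -(xK _ jp) /u; ring.
Qed.

(** * Node values by telescoping *)

(** Write z^a - z^b = (z^a - z^j) - (z^b - z^j): times x_j, the first part extends [NP] to j+1, the
    second extends [NQ] to j-1. *)
Let NPNQ_telescope a b j : (0 < j < p)%N ->
  (z ^+ a - z ^+ b) * (x j * NP a j * NQ b j)
  = NP a j.+1 * NQ b j - NP a j * NQ b j.-1.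
Proof.
case: j => // j /= lt_jp; rewrite (NP_S a j.+1) // (NQ_S b _ lt_jp); ring.
Qed.

(* Equals [u_a u_b G(u_a, u_b)]. *)
Let h a b := u a * u b * \sum_(1 <= j < p) z ^+ j * x j ^+ 2 * NP a j * NQ b j.

(** One factor u_a x_j makes [NP] a difference; the other factors, u_(b+1) z^j x_j, lower the second
    node from b+1 to b. *)
Let hE a b : h a b.+1 = \sum_(0 <= j < p.-1) (NP a j.+2 - NP a j.+1) * NQ b j.
Proof.
rewrite /h big_add1 big_distrr; apply: eq_big_nat => j jp /=.
have lt_jp : (0 < j.+1 < p)%N by lia.
rewrite -(uxNP _ _ lt_jp) (NQ_shift b j); last by case/andP: lt_jp.
ring.
Qed.

Let h_step a b : (0 < a < p.-1)%N -> (b < p)%N -> a != b ->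
  h a b.+1 = h a.+1 b.+1.
Proof.
move=> /andP[a0 ap] bp neq_ab.
have ap' : (a < p)%N by lia.
have zab : z ^+ a - z ^+ b != 0.
  by rewrite subr_eq0; apply: contraNneq neq_ab => /zpow_inj->.
apply/eqP; rewrite -subr_eq0 !hE -sumrB /=.
have p2 : (0 < p.-1)%N by lia.
(* The term j = 0 is split off, since [NP_qderiv] requires a positive index; it contributes z^a
   [NQ b 0]. *)
rewrite big_ltn // -mulrBl !NP1.
have -> : NP a 2 - 1 - (NP a.+1 2 - 1) = z ^+ a.
  by rewrite -[RHS]mulr1 -[1 in RHS](NP1 a) -NP_qderiv; [ring | lia].
have -> : \sum_(1 <= j < p.-1) ((NP a j.+2 - NP a j.+1) * NQ b j
             - (NP a.+1 j.+2 - NP a.+1 j.+1) * NQ b j)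
   = \sum_(1 <= j < p.-1) z ^+ a * u a * (x j * NP a j * NQ b j).
  apply: eq_big_nat => j /andP[j0 jp].
  have -> : z ^+ a * u a * (x j * NP a j * NQ b j)
    = z ^+ a * (NP a j.+1 - NP a j) * NQ b j.
    by rewrite -uxNP; [ring | lia].
  by rewrite mulrBr -!NP_qderiv; [ring | lia | lia].
rewrite -big_distrr /=.
rewrite -(mulrI_eq0 _ (mulfI zab)) mulrDr [_ * (_ * _ * _)]mulrCA big_distrr /=.
under eq_big_nat => j jp do
  (rewrite NPNQ_telescope; last by lia).
(* The upper boundary term vanishes because 0 < a < p-1. With the term j = 0, the lower one leaves
   z^a (1 - z^b) [NQ b 0], which is 0: by its first factor z^b - z^b if b > 0, by 1 - z^0 if b =
   0. *)
rewrite (@telescope_sumr_eq _ _ _ (fun j => NP a j * NQ b j.-1)) //.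
rewrite (@NP_eq0 a p.-1) ?a0 // mul0r sub0r NP1 mul1r /=.
have : NQ b 0 * (1 - z ^+ b) = 0.
  case: (posnP b) => [->|b0]; first by rewrite expr0 subrr mulr0.
  by rewrite NQ_eq0 ?b0 // mul0r.
move=> e; apply/eqP; transitivity (z ^+ a * (NQ b 0 * (1 - z ^+ b))).
  by rewrite /u; ring.
by rewrite e mulr0.
Qed.

(** The product does not depend on a: [NP_shift] and [NQ_shift] exchange the same factor z^(a+1)
    u_(a+1) x_(a+1). *)
Let NPNQ_diag a : (a < p)%N -> NP a.+1 a.+1 * NQ a a = 1.
Proof.
elim: a => [|a IHa] ap.
  rewrite NP1 mul1r /NQ big_nat big1 // => k kp.
  by rewrite expr0 mulrC xK.
rewrite -(IHa (ltnW ap)) (NQ_shift a a) // (NP_shift a.+1) //; ring.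
Qed.

(** In [hE] for the node pair (a+1, a+1), [NQ] kills the terms j < a and [NP] those with j > a; at j
    = a only - [NP a.+1 a.+1 * NQ a a] is left. *)
Let h_diag a : (0 < a < p)%N -> h a a = -1.
Proof.
case: a => // a /= ap; rewrite hE (bigD1_seq a) ?iota_uniq //=; last first.
  by rewrite mem_index_iota; lia.
rewrite big_nat_cond big1 ?addr0 => [|j /andP[jp neq_ja]]; last first.
  case: (ltnP j a) => [lt_ja|le_aj]; first by rewrite NQ_eq0 ?mulr0 //; lia.
  by rewrite !NP_eq0 ?subrr ?mul0r //; lia.
by rewrite (@NP_eq0 _ a.+2) ?sub0r ?mulNr ?NPNQ_diag //; lia.
Qed.

(** Climbs in a from the diagonal; the value a = b-1 excluded by [h_step] lies just below the
    range. *)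
Let h_lower a b : (0 < b <= a)%N -> (a < p)%N -> h a b = -1.
Proof.
case/andP=> b0 le_ba; rewrite -(subnKC le_ba); elim: (a - b)%N => [|d IHd].
  by rewrite addn0 => bp; rewrite h_diag // b0.
rewrite addnS => bp; rewrite -IHd; last by lia.
by case: b b0 le_ba bp {IHd} => // b _ _ bp; rewrite -h_step //; lia.
Qed.

Let NPNQ_upper a b j : (0 < a < b)%N -> (b < p)%N -> NP a j * NQ b j = 0.
Proof.
move=> ab bp; case: (ltnP a j) => [lt_aj|le_ja].
  by rewrite NP_eq0 ?mul0r //; lia.
by rewrite NQ_eq0 ?mulr0 //; lia.
Qed.

Let h_upper a b : (0 < a < b)%N -> (b < p)%N -> h a b = 0.
Proof.
move=> ab bp; rewrite /h big1 ?mulr0 // => j _.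
by rewrite -mulrA NPNQ_upper ?mulr0.
Qed.

(** The analogue of [h] for the weight x_j, without the factor u_a u_b; its coefficients are
    elementary symmetric functions by [L_x]. *)
Let X a b := \sum_(1 <= j < p) x j * NP a j * NQ b j.

Let X_offdiag a b : (0 < a < p)%N -> (0 < b < p)%N -> a != b -> X a b = 0.
Proof.
move=> ap bp neq_ab.
have zab : z ^+ a - z ^+ b != 0.
  rewrite subr_eq0; apply: contraNneq neq_ab => /zpow_inj-> //; lia.
apply/eqP; rewrite -(mulrI_eq0 _ (mulfI zab)) big_distrr /=.
under eq_big_nat => j jp do rewrite NPNQ_telescope //.
rewrite (@telescope_sumr_eq _ _ _ (fun j => NP a j * NQ b j.-1)) //; last by lia.
by rewrite (@NP_eq0 a p) // (@NQ_eq0 b 0) // mul0r mulr0 subrr.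
Qed.

(** In both [h a a] and [X a a] only j = a survives. Since u_a x_a = -1, the value h = -1 yields
    that of X. *)
Let X_diag a : (0 < a < p)%N -> u a * z ^+ a * X a a = 1.
Proof.
move=> ap.
have single (f : nat -> K) :
    \sum_(1 <= j < p) f j * NP a j * NQ a j = f a * NP a a * NQ a a.
  rewrite (bigD1_seq a) ?iota_uniq ?mem_index_iota //=.
  rewrite big_nat_cond big1 ?addr0 // => j /andP[jp neq_ja].
  case: (ltnP j a) => [lt_ja|le_aj]; first by rewrite NQ_eq0 ?mulr0 //; lia.
  by rewrite NP_eq0 ?mulr0 ?mul0r //; lia.
have := h_diag _ ap; rewrite /h /X !(single) => hd.
apply: oppr_inj; rewrite -hd.
transitivity (u a * x a * (u a * x a * (z ^+ a * NP a a * NQ a a))); last by ring.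
by rewrite ux //; transitivity (- ((u a * x a) * (z ^+ a * NP a a * NQ a a)));
  [ring | rewrite ux //; ring].
Qed.

(** * Interpolation: from node values back to coefficients *)

Let P j := \prod_(1 <= k < j) (1 + x k *: 'X).
Let Q j := \prod_(j.+1 <= k < p) (1 + x k *: 'X).

Let affine_node a k : (0 < k < p)%N ->
  (1 + x k *: 'X).[u a] = (z ^+ a - z ^+ k) * x k.
Proof.
move=> kp; rewrite hornerD hornerZ hornerX -polyC1 hornerC -(xK _ kp) /u.
ring.
Qed.

Let P_node a j : (j <= p)%N -> (P j).[u a] = NP a j.
Proof.
move=> jp; rewrite /P horner_prod; apply: eq_big_nat => k kj.
by rewrite affine_node //; lia.
Qed.

Let Q_node b j : (Q j).[u b] = NQ b j.
Proof.
rewrite /Q horner_prod; apply: eq_big_nat => k kj.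
by rewrite affine_node //; lia.
Qed.

Let p_gt0 : (0 < p)%N := prim_order_gt0 zP.

Let size_P j : (0 < j < p)%N -> (size (P j) <= p.-1)%N.
Proof. by move=> jp; apply: leq_trans (size_prod_affine _ _ _ _) _; lia. Qed.

Let size_Q j : (0 < j < p)%N -> (size (Q j) <= p.-1)%N.
Proof. by move=> jp; apply: leq_trans (size_prod_affine _ _ _ _) _; lia. Qed.

Let size_Q0 : (size (Q 0) <= p)%N.
Proof. by apply: leq_trans (size_prod_affine _ _ _ _) _; lia. Qed.

(** Substituting X + 1 in the factorization of X^p - 1 gives (X+1)^p - 1 as X [Q 0] times the
    product of the 1 - z^k; the coefficient of X shows that this product is p. *)
Lemma prod_affine_coef t : p%:R * (Q 0)`_t = 'C(p, t.+1)%:R.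
Proof.
have XQ : (\prod_(1 <= k < p) (1 - z ^+ k))%:P * ('X * Q 0) = ('X + 1) ^+ p - 1.
  transitivity (('X^p - 1) \Po ('X + 1%:P : {poly K})); last first.
    by rewrite comp_polyB comp_Xn_poly polyC1 -polyC1 comp_polyC.
  rewrite -(factor_Xn_sub_1 zP) [RHS]rmorph_prod /= [RHS]big_ltn //.
  rewrite comp_polyB comp_polyX comp_polyC expr0 addrK mulrCA.
  congr (_ * _); rewrite rmorph_prod -big_split /=; apply: eq_big_nat => k kp.
  rewrite comp_polyB comp_polyX comp_polyC mulrDr mulr1 -mul_polyC mulrA -polyCM.
  rewrite [_ * x k]mulrC xK // mul1r !polyCB polyC1; ring.
have coefXQ i : (('X + 1) ^+ p - 1 : {poly K})`_i.+1 = 'C(p, i.+1)%:R.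
  have -> : ('X + 1) ^+ p = \poly_(i < p.+1) 'C(p, i)%:R :> {poly K}.
    rewrite addrC exprDn poly_def; apply: eq_bigr => j _.
    by rewrite expr1n mul1r scaler_nat.
  rewrite coefB coef1 subr0 coef_poly; case: ltnP => // lt_pi.
  by rewrite bin_small.
have eq_p : \prod_(1 <= k < p) (1 - z ^+ k) = p%:R.
  move: (coefXQ 0%N); rewrite -XQ coefCM coefXM /= coef0_prod_affine mulr1 bin1.
  exact.
by rewrite -(coefXQ t) -XQ coefCM coefXM eq_p.
Qed.

Let e t := (Q 0)`_t.

Let e_eq0 t : (p <= t)%N -> e t = 0.
Proof. by move=> le_pt; apply: nth_default; apply: leq_trans le_pt. Qed.

(** The coefficient of u^i v^j in the sum over k of phi_k P_k(u) Q_k(v). *)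
Let L (phi : nat -> K) i j :=
  \sum_(1 <= k < p) (P k)`_i * (phi k * (Q k)`_j).

Let L_nsum (T : Type) (w : T -> nat -> K) c d i j :
  (forall k, w c k = x k) ->
  nsum w p (nseq i c ++ d :: nseq j c) 0 = L (w d) i j.
Proof.
move=> wx; have Pw m n : \prod_(m <= k < n) (1 + w c k *: 'X)
    = \prod_(m <= k < n) (1 + x k *: 'X).
  by apply: eq_bigr => k _; rewrite wx.
rewrite nsum_nseq_cons; apply: eq_big_nat => k /andP[_ kp].
by rewrite nsum_nseq // !Pw.
Qed.

(** With weight x_k at the marked letter too, the word is i+j+1 equal letters. *)
Let L_x i j : L x i j = e (i + j).+1.
Proof.
rewrite -(@L_nsum unit (fun=> x) tt tt) // -[_ :: _]/(nseq j.+1 tt).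
rewrite -nseqD addnS nsum_nseq //.
Qed.

Let L_node phi a b :
  \sum_(0 <= i < p.-1) \sum_(0 <= j < p.-1) L phi i j * u a ^+ i * u b ^+ j
  = \sum_(1 <= k < p) phi k * NP a k * NQ b k.
Proof.
transitivity (\sum_(0 <= i < p.-1) \sum_(0 <= j < p.-1) \sum_(1 <= k < p)
  phi k * ((P k)`_i * u a ^+ i) * ((Q k)`_j * u b ^+ j)).
  apply: eq_bigr => i _; apply: eq_bigr => j _; rewrite -mulrA big_distrl /=.
  by apply: eq_bigr => k _; ring.
under eq_bigr => i _ do rewrite exchange_big /=.
rewrite exchange_big /=; apply: eq_big_nat => k kp.
rewrite -P_node -?Q_node; last by lia.
rewrite (horner_coef_wide _ (size_P _ kp)) (horner_coef_wide _ (size_Q _ kp)).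
rewrite !(big_mkord xpredT) -mulrA big_distrlr /= big_distrr /=.
apply: eq_bigr => i _; rewrite big_mkord big_distrr /=.
by apply: eq_bigr => j _; rewrite mulrA.
Qed.

(** [Q 0] vanishes at u_b and has constant term 1. *)
Let e_node b : (0 < b < p)%N ->
  u b * \sum_(0 <= j < p.-1) e j.+1 * u b ^+ j = -1.
Proof.
move=> bp; have := Q_node b 0; rewrite (NQ_eq0 b 0) //.
rewrite (horner_coef_wide _ size_Q0).
rewrite -(big_mkord xpredT (fun i => e i * u b ^+ i)).
rewrite big_ltn // [e 0]coef0_prod_affine mulr1 big_add1 => /eqP.
rewrite addrC addr_eq0 => /eqP <-; rewrite big_distrr /=.
by apply: eq_bigr => j _; rewrite mulrCA exprS.
Qed.

Let e2_node a b : (0 < b < p)%N ->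
  u a * u b * (\sum_(0 <= i < p.-1) \sum_(0 <= j < p.-1)
                 e (i + j).+2 * u a ^+ i * u b ^+ j)
  = u b * X a b + 1.
Proof.
move=> bp; pose R i := \sum_(0 <= j < p.-1) e (i + j).+1 * u b ^+ j.
have XE : X a b = \sum_(0 <= i < p.-1) R i * u a ^+ i.
  rewrite /X -L_node; apply: eq_bigr => i _; rewrite big_distrl /=.
  by apply: eq_bigr => j _; rewrite L_x mulrAC.
(* Shifting i by one brings in index p-1; as e_t = 0 for t >= p, the range can stay the same. *)
have R_last : R p.-1 = 0.
  by rewrite /R big1 // => j _; rewrite e_eq0 ?mul0r //; lia.
have XS : X a b = R 0%N + u a * \sum_(0 <= i < p.-1) R i.+1 * u a ^+ i.
  have -> : X a b = \sum_(0 <= i < p.-1.+1) R i * u a ^+ i.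
    by rewrite big_nat_recr //= R_last mul0r addr0 XE.
  rewrite big_nat_recl // mulr1 big_distrr /=; congr (_ + _).
  by apply: eq_bigr => i _; rewrite exprS mulrCA.
rewrite XS [u b * (_ + _)]mulrDr [u b * R 0%N]e_node // mulrA.
rewrite [_ * u a]mulrC addrAC addNr add0r.
congr (_ * _); apply: eq_bigr => i _; rewrite big_distrl /=.
by apply: eq_bigr => j _; rewrite addSn mulrAC.
Qed.

Let y k := z ^+ k * x k ^+ 2.

Let u_inj a b : (0 < a < p)%N -> (0 < b < p)%N -> u a = u b -> a = b.
Proof. by move=> ap bp /addIr/zpow_inj; apply; lia. Qed.

Let N i j := L y i j + L y j i + e (i + j).+1 + e (i + j).+2.

(** After multiplication by u_a u_b the value is h(a,b) + h(b,a) + 1 + u_b z^a X(a,b): this is -1 +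
    0 + 1 + 0 off the diagonal and -1 - 1 + 1 + 1 on it. *)
Let N_node a b : (0 < a < p)%N -> (0 < b < p)%N ->
  \sum_(0 <= i < p.-1) \sum_(0 <= j < p.-1) N i j * u a ^+ i * u b ^+ j = 0.
Proof.
move=> ap bp; apply/eqP.
rewrite -(mulrI_eq0 _ (mulfI (mulf_neq0 (u_neq0 _ ap) (u_neq0 _ bp)))).
have -> : u a * u b *
   (\sum_(0 <= i < p.-1) \sum_(0 <= j < p.-1) N i j * u a ^+ i * u b ^+ j)
  = h a b + h b a + u a * u b * X a b + (u b * X a b + 1).
  rewrite -(e2_node a b bp) /h /X [u b * u a]mulrC -!(mulrDr (u a * u b)).
  congr (_ * _).
  rewrite -!L_node [X in _ + X + _ + _]exchange_big /= -!big_split /=.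
  apply: eq_bigr => i _; rewrite -!big_split /=; apply: eq_bigr => j _.
  by rewrite L_x /N; ring.
have -> : h a b + h b a + u a * u b * X a b + (u b * X a b + 1)
   = h a b + h b a + 1 + u b * z ^+ a * X a b by rewrite /u; ring.
case: (ltngtP a b) => [lt_ab|lt_ba|eq_ab].
- rewrite h_upper ?h_lower ?X_offdiag //; try lia.
  by rewrite mulr0 addr0 add0r addNr.
- rewrite h_lower ?h_upper ?X_offdiag //; try lia.
  by rewrite mulr0 !addr0 addNr.
- by rewrite -eq_ab h_diag // X_diag // addrNK addNr.
Qed.

Let N_eq0 i j : (i < p.-1)%N -> (j < p.-1)%N -> N i j = 0.
Proof.
apply: (bivariate_coef_vanish _ _ [seq u a | a <- iota 1 p.-1]).
- rewrite map_inj_in_uniq ?iota_uniq // => a b; rewrite !mem_iota => ap bp.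
  by apply: u_inj; lia.
- by rewrite size_map size_iota.
move=> _ _ /mapP[a ap ->] /mapP[b bp ->]; move: ap bp.
by rewrite !mem_iota => ap bp; apply: N_node; lia.
Qed.

Lemma nsum_hook_root_of_unity a b : (a + b + 1 < p)%N ->
  p%:R * (nsum (fun s k => z ^+ (s.-1 * k) * (1 - z ^+ k)^-1 ^+ s) p
            (nseq a 1%N ++ 2%N :: nseq b 1%N) 0
        + nsum (fun s k => z ^+ (s.-1 * k) * (1 - z ^+ k)^-1 ^+ s) p
            (nseq b 1%N ++ 2%N :: nseq a 1%N) 0)
  = - 'C(p + 1, a + b + 3)%:R.
Proof.
move=> abp; set w := fun s k => _.
have w1 k : w 1%N k = x k by rewrite /w mul0n expr0 mul1r.
have w2 i j : L (w 2%N) i j = L y i j.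
  by apply: eq_bigr => k _; rewrite /w mul1n.
rewrite !L_nsum // !w2.
have /eqP : N a b = 0 by apply: N_eq0; lia.
rewrite /N -addrA addr_eq0 => /eqP->.
(* Pascal's rule adds C(p, a+b+2) and C(p, a+b+3). *)
rewrite mulrN mulrDr !prod_affine_coef -natrD addnC -binS.
by congr (- ('C(_, _))%:R); lia.
Qed.

End RootOfUnity.

(** * Specialization of rational functions at primitive p-th roots of unity *)

Section Specialization.

Variable p : nat.
Hypothesis p_prime : prime p.

Let toC (f : {poly int}) : {poly algC} := map_poly intr f.

Let toC_hornerD (f g : {poly int}) z :
  (toC (f + g)).[z] = (toC f).[z] + (toC g).[z].
Proof. by rewrite /toC rmorphD hornerD. Qed.

Let toC_hornerM (f g : {poly int}) z :
  (toC (f * g)).[z] = (toC f).[z] * (toC g).[z].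
Proof. by rewrite /toC rmorphM hornerM. Qed.

(** Evaluation makes sense only for fractions whose denominator is nonzero at these roots, hence a
    relation carrying a witness f/g. *)
Definition specializes (r : ratfun) (c : algC -> algC) : Prop :=
  exists f g : {poly int}, r = ratfun_of_zpoly f / ratfun_of_zpoly g /\
    forall z : algC, p.-primitive_root z ->
      (toC g).[z] != 0 /\ (toC f).[z] = c z * (toC g).[z].

Let zpoly_neq0 (g : {poly int}) :
  (forall z : algC, p.-primitive_root z -> (toC g).[z] != 0) ->
  ratfun_of_zpoly g != 0.
Proof.
move=> gz; have [z /gz] := C_prim_root_exists (prime_gt0 p_prime).
apply: contra_neq => /eqP; rewrite tofrac_eq0 => /eqP g0.
suff -> : g = 0 by rewrite /toC rmorph0 horner0.
apply: (map_inj_poly (intr_inj : injective (intr : int -> rat))) => //.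
by rewrite g0 rmorph0.
Qed.

Lemma specializes_ext r c c' :
  (forall z, p.-primitive_root z -> c z = c' z) ->
  specializes r c -> specializes r c'.
Proof.
move=> cc' [f [g [-> fg]]]; exists f, g; split=> // z zP.
by rewrite -cc' //; apply: fg.
Qed.

Lemma specializes_zpoly f :
  specializes (ratfun_of_zpoly f) (fun z => (toC f).[z]).
Proof.
exists f, 1; split; first by rewrite /ratfun_of_zpoly !rmorph1 divr1.
by move=> z _; rewrite /toC rmorph1 hornerC oner_eq0 mulr1.
Qed.

Lemma specializesD r1 c1 r2 c2 : specializes r1 c1 -> specializes r2 c2 ->
  specializes (r1 + r2) (fun z => c1 z + c2 z).
Proof.
move=> [f1 [g1 [-> e1]]] [f2 [g2 [-> e2]]].
have g1_neq0 : ratfun_of_zpoly g1 != 0 by apply: zpoly_neq0 => z /e1[].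
have g2_neq0 : ratfun_of_zpoly g2 != 0 by apply: zpoly_neq0 => z /e2[].
exists (f1 * g2 + f2 * g1), (g1 * g2); split.
  by rewrite addf_div // /ratfun_of_zpoly !(rmorphD, rmorphM).
move=> z zP; have [g1z f1z] := e1 z zP; have [g2z f2z] := e2 z zP.
rewrite !(toC_hornerD, toC_hornerM) mulf_neq0 //; split=> //.
by rewrite f1z f2z; ring.
Qed.

Lemma specializesM r1 c1 r2 c2 : specializes r1 c1 -> specializes r2 c2 ->
  specializes (r1 * r2) (fun z => c1 z * c2 z).
Proof.
move=> [f1 [g1 [-> e1]]] [f2 [g2 [-> e2]]].
exists (f1 * f2), (g1 * g2); split.
  by rewrite mulf_div /ratfun_of_zpoly !rmorphM.
move=> z zP; have [g1z f1z] := e1 z zP; have [g2z f2z] := e2 z zP.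
rewrite !toC_hornerM mulf_neq0 //; split=> //.
by rewrite f1z f2z; ring.
Qed.

Lemma specializesV r c : specializes r c ->
  (forall z, p.-primitive_root z -> c z != 0) ->
  specializes r^-1 (fun z => (c z)^-1).
Proof.
move=> [f [g [-> e]]] c_neq0; exists g, f; split; first by rewrite invf_div.
move=> z zP; have [gz fz] := e z zP; rewrite fz mulf_neq0 ?c_neq0 //.
by split=> //; rewrite mulKf ?c_neq0.
Qed.

Lemma specializes_nat n : specializes n%:R (fun=> n%:R).
Proof.
have := specializes_zpoly n%:R; rewrite /ratfun_of_zpoly !rmorph_nat.
by apply: specializes_ext => z _; rewrite /toC rmorph_nat hornerMn hornerC.
Qed.

Lemma specializesN r c : specializes r c -> specializes (- r) (fun z => - c z).
Proof.
move=> rc; rewrite -mulN1r; have := specializes_zpoly (-1).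
rewrite /ratfun_of_zpoly !rmorphN !rmorph1 => /specializesM/(_ rc).
by apply: specializes_ext => z _; rewrite /toC rmorphN1 hornerN hornerC mulN1r.
Qed.

Lemma specializesX r c n : specializes r c ->
  specializes (r ^+ n) (fun z => c z ^+ n).
Proof.
move=> rc; elim: n => [|n IHn]; first exact: (specializes_nat 1).
rewrite exprS; apply: specializes_ext (specializesM _ _ _ _ rc IHn) => z _.
by rewrite exprS.
Qed.

Lemma specializes_sum (I : eqType) (s : seq I) (F : I -> ratfun) c :
  (forall i, i \in s -> specializes (F i) (c i)) ->
  specializes (\sum_(i <- s) F i) (fun z => \sum_(i <- s) c i z).
Proof.
elim: s => [|i s IHs] Fc.
  rewrite big_nil; apply: specializes_ext (specializes_nat 0) => z _.
  by rewrite big_nil.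
rewrite big_cons.
have Fi : specializes (F i) (c i) by apply: Fc; rewrite mem_head.
have Fs : specializes (\sum_(i <- s) F i) (fun z => \sum_(i <- s) c i z).
  by apply: IHs => j js; apply: Fc; rewrite in_cons js orbT.
apply: specializes_ext (specializesD _ _ _ _ Fi Fs) => z _.
by rewrite big_cons.
Qed.

Lemma specializes_qvar : specializes qvar id.
Proof.
have := specializes_zpoly 'X; rewrite /ratfun_of_zpoly map_polyX.
by apply: specializes_ext => z _; rewrite /toC map_polyX hornerX.
Qed.

Lemma specializes_qint k : specializes (qint qvar k) (fun z => qint z k).
Proof.
rewrite /qint -(big_mkord xpredT (fun i => qvar ^+ i)).
apply: specializes_ext (specializes_sum _ _ _ (fun i z => z ^+ i) _) => [z _|i _].
  by rewrite big_mkord.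
exact: specializesX specializes_qvar.
Qed.

Lemma qint_geom (R : nzRingType) (x : R) k : (1 - x) * qint x k = 1 - x ^+ k.
Proof. by rewrite -[RHS]opprB subrX1 -mulNr opprB. Qed.

Lemma qint_neq0 (z : algC) k : p.-primitive_root z -> (0 < k < p)%N ->
  qint z k != 0.
Proof.
move=> zP kp; have := prim_root_sub1_neq0 _ _ _ zP _ kp.
by rewrite -qint_geom mulf_eq0 negb_or => /andP[].
Qed.

(** All indices satisfy 0 < k < p, so no [k]_z vanishes. *)
Lemma specializes_nsum s m :
  specializes
    (nsum (fun s k => qvar ^+ (s.-1 * k) / qint qvar k ^+ s) p s m)
    (fun z => nsum (fun s k => z ^+ (s.-1 * k) / qint z k ^+ s) p s m).
Proof.
elim: s m => [|c s IHs] m /=; first exact: (specializes_nat 1).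
apply: specializes_sum => k; rewrite mem_index_iota => kp.
apply: specializesM => //; apply: specializesM.
  exact: specializesX specializes_qvar.
apply: specializesV; first exact: specializesX (specializes_qint k).
by move=> z zP; rewrite expf_neq0 // qint_neq0 //; lia.
Qed.

(** * The polynomial [p]_q and congruence modulo it *)

Lemma horner_qint (R : nzRingType) (z : R) k : (qint 'X k).[z] = qint z k.
Proof. by rewrite horner_sum; apply: eq_bigr => i _; rewrite hornerXn. Qed.

Lemma map_qint (R S : nzRingType) (f : {rmorphism R -> S}) k :
  map_poly f (qint 'X k) = qint 'X k.
Proof. by rewrite rmorph_sum; apply: eq_bigr => i _; rewrite /= map_polyXn. Qed.

Lemma subX1_qint (R : nzRingType) k :
  ('X - 1) * qint 'X k = 'X^k - 1 :> {poly R}.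
Proof. by rewrite subrX1. Qed.

Lemma monic_qint (R : nzRingType) k :
  (0 < k)%N -> qint 'X k \is @monic R.
Proof.
move=> k0; rewrite -(monicMl _ (monicXsubC 1)) polyC1 subX1_qint.
exact: monicXnsubC.
Qed.

Lemma size_qint (R : nzRingType) k :
  (0 < k)%N -> size (qint 'X k : {poly R}) = k.
Proof.
move=> k0; apply/eqP; rewrite -eqSS -(@size_XnsubC R k 1 k0) polyC1 -subX1_qint.
by rewrite -polyC1 size_monicM ?monicXsubC ?size_XsubC ?monic_neq0 ?monic_qint.
Qed.

(** A root has order dividing p, and order 1 is excluded because [p]_1 = p is nonzero. *)
Lemma root_qint_prime (z : algC) :
  root (qint 'X p) z = (p.-primitive_root z).
Proof.
apply/idP/idP => [|zP]; last first.
  have p1 : (0 < 1 < p)%N by rewrite prime_gt1.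
  rewrite /root horner_qint; apply/eqP.
  apply: (mulfI (prim_root_sub1_neq0 _ _ _ zP _ p1)).
  by rewrite expr1 qint_geom (prim_expr_order zP) subrr mulr0.
rewrite /root horner_qint => /eqP qz0.
have zp1 : z ^+ p = 1.
  by apply/esym/eqP; rewrite -subr_eq0 -qint_geom qz0 mulr0.
have [m zm] := prim_order_exists (prime_gt0 p_prime) zp1.
case/primeP: (p_prime) => _ /[apply] /orP[/eqP m1|/eqP <- //].
have z1 : z = 1 by rewrite -(prim_expr_order zm) m1.
have := qz0; rewrite z1 /qint (eq_bigr (fun=> 1)) => [|i _]; last first.
  by rewrite expr1n.
move/eqP; rewrite sumr_const card_ord Num.Theory.pnatr_eq0.
by rewrite -leqn0 leqNgt prime_gt0.
Qed.

(* The [p.-1] powers of a primitive root kill the remainder of [f] modulo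
   the monic [p]_q, so no irreducibility argument is needed. *)
Lemma qint_dvd_of_roots (f : {poly int}) :
  (forall z : algC, p.-primitive_root z -> (toC f).[z] = 0) ->
  exists h : {poly int}, f = h * qint 'X p.
Proof.
move=> fz; have p0 := prime_gt0 p_prime.
have mon := @monic_qint int p p0.
exists (Pdiv.Ring.rdivp f (qint 'X p)).
have := Pdiv.RingMonic.rdivp_eq mon f; set r := Pdiv.Ring.rmodp _ _ => eq_f.
suff r0 : r = 0 by rewrite {1}eq_f r0 addr0.
have [z zP] := C_prim_root_exists p0.
apply: (map_inj_poly (intr_inj : injective (intr : int -> algC))) => //.
rewrite rmorph0; apply: (@roots_geq_poly_eq0 _ _ [seq z ^+ i | i <- iota 1 p.-1]).
- apply/allP => _ /mapP[i + ->]; rewrite mem_iota => ip.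
  have wP : p.-primitive_root (z ^+ i).
    rewrite (prim_root_exp_coprime _ zP) coprime_sym prime_coprime //.
    by apply/negP => /dvdn_leq; lia.
  have := fz _ wP; rewrite eq_f toC_hornerD toC_hornerM.
  have -> : (toC (qint 'X p)).[z ^+ i] = 0.
    by rewrite /toC map_qint; apply/eqP; rewrite -/(root _ _) root_qint_prime.
  by rewrite mulr0 add0r /root => ->.
- rewrite map_inj_in_uniq ?iota_uniq // => i j; rewrite !mem_iota => ip jp.
  move/eqP; rewrite (eq_prim_root_expr zP) !modn_small; [by move/eqP|lia|lia].
rewrite size_map size_iota -ltnS prednK //.
rewrite (leq_ltn_trans (size_poly _ _)) // -[X in (_ < X)%N](@size_qint int p p0).
by rewrite Pdiv.Ring.ltn_rmodpN0 // monic_neq0.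
Qed.

(** Coprimality may be tested over [algC], where the roots of [p]_q are exactly the points at which
    g is known not to vanish; f vanishes at all of them. *)
Lemma qcong_of_specializes A B :
  specializes (A - B) (fun=> 0) -> qcong p A B.
Proof.
move=> [f [g [eqAB fg]]]; exists f, g; split=> //.
  rewrite -(coprimep_map (ratr : {rmorphism rat -> algC})) map_qint.
  rewrite -map_poly_comp (eq_map_poly (ratr_int _)).
  apply/Pdiv.ClosedField.coprimepP => z gz0; rewrite -[_ == 0]/(root _ z).
  rewrite root_qint_prime; apply/negP => /fg[] /negP gz _; apply: gz.
  exact: gz0.
by apply: qint_dvd_of_roots => z /fg[_ ->]; rewrite mul0r.
Qed.

End Specialization.

(** * Passage to the q-harmonic sums *)

Lemma nsum_scale (R : comNzRingType) (c : R) (w : nat -> nat -> R) n s m :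
  nsum (fun s k => c ^+ s * w s k) n s m = c ^+ sumn s * nsum w n s m.
Proof.
elim: s m => [|d s IHs] m /=; first by rewrite mul1r.
rewrite big_distrr /=; apply: eq_bigr => k _; rewrite IHs exprD; ring.
Qed.

Lemma eq_nsum (R : nzRingType) (T : Type) (w w' : T -> nat -> R) n s m :
  (forall c k, (m < k < n)%N -> w c k = w' c k) ->
  nsum w n s m = nsum w' n s m.
Proof.
elim: s m => //= d s IHs m ww'; apply: eq_big_nat => k /andP[mk kn].
rewrite ww' ?mk // (IHs k) // => c l /andP[kl ln].
by rewrite ww' // ln (ltn_trans mk kl).
Qed.

(** Since 1/[k]_z = (1-z)/(1-z^k), a letter s contributes (1-z)^s. *)
Lemma nsum_qint (z : algC) p s : prime p -> p.-primitive_root z ->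
  nsum (fun s k => z ^+ (s.-1 * k) / qint z k ^+ s) p s 0
  = (1 - z) ^+ sumn s
    * nsum (fun s k => z ^+ (s.-1 * k) * (1 - z ^+ k)^-1 ^+ s) p s 0.
Proof.
move=> p_prime zP; rewrite -nsum_scale; apply: eq_nsum => c k kp.
rewrite -qint_geom mulrCA; congr (_ * _); rewrite -exprVn -exprMn.
have z1 : 1 - z != 0.
  by rewrite -[z]expr1 (prim_root_sub1_neq0 _ _ _ zP) // prime_gt1.
by rewrite invfM mulrA divff // mul1r.
Qed.

Lemma qMHS_nsum n s :
  qMHS n s
  = nsum (fun s k => qvar ^+ (s.-1 * k) / qint qvar k ^+ s) n.+1 s 0.
Proof. by rewrite -(tuple_nsum _ _ 0%N). Qed.

Theorem theorem8p3 (a b t p : nat) (ht : t = (a + b + 1)%N)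
    (p_prime : prime p) (lt_tp : (t < p)%N) :
  qcong p
    (qMHS (p - 1) (nseq a 1%N ++ [:: 2%N] ++ nseq b 1%N)
     + qMHS (p - 1) (nseq b 1%N ++ [:: 2%N] ++ nseq a 1%N))
    (- ('C(p + 1, t + 2)%:R * ((1 - qvar) ^+ (t + 1) / p%:R))).
Proof.
have p0 := prime_gt0 p_prime.
have pC (z : algC) : p.-primitive_root z -> p%:R != 0 :> algC.
  by move=> _; rewrite Num.Theory.pnatr_eq0 -lt0n.
apply: qcong_of_specializes => //; rewrite opprK !qMHS_nsum subn1 prednK //.
have spN := specializes_nsum _ p_prime.
have sp1q := specializesD _ p_prime _ _ _ _ (specializes_nat p 1)
               (specializesN _ _ _ (specializes_qvar p)).
apply: specializes_ext (specializesD _ p_prime _ _ _ _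
  (specializesD _ p_prime _ _ _ _ (spN _ 0%N) (spN _ 0%N))
  (specializesM _ _ _ _ _ (specializes_nat p _)
     (specializesM _ _ _ _ _ (specializesX _ _ _ (t + 1) sp1q)
        (specializesV _ _ _ (specializes_nat p p) pC)))) => z zP /=.
rewrite !nsum_qint // !sumn_cat /= !sumn_nseq !mul1n.
(* Both words have weight t+1, so (1-z)^(t+1) is a common factor. *)
have -> : (b + (2 + a) = t + 1)%N by lia.
have -> : (a + (2 + b) = t + 1)%N by lia.
have abp : (a + b + 1 < p)%N by rewrite -ht.
rewrite -mulrDr -[_ + nsum _ _ _ _](mulKf (pC z zP)).
rewrite (nsum_hook_root_of_unity _ _ _ zP _ _ abp).
have -> : (a + b + 3 = t + 2)%N by lia.
by field; apply: pC zP.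
Qed.
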